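(* Let $\bm{\gamma}: I \to \mathbb{R}^3$ be a curve admitting a generalized Frenet frame, let $k \in \mathbb{Z}$, and let $\{\bm{t}_k, \bm{d}_k, \bm{t}_{k+1}\}$ be a $k$th-order Frenet frame along $\bm{\gamma}$ with $k$th-order curvature $\kappa_k$ and $k$th-order torsion $\tau_k$. Assume that $(\kappa_k(t), \tau_k(t)) \neq (0,0)$ for all $t \in I$, and write $$(\kappa_k(t), \tau_k(t)) = (r_k(t)\cos\theta_k(t),\; r_k(t)\sin\theta_k(t)),$$ where $r_k(t) = \sqrt{\kappa_k^2(t)+\tau_k^2(t)}$ is the norm and $\theta_k: I \to \mathbb{R}$ is a smooth argument function of the vector $(\kappa_k(t),\tau_k(t))$. Let $$\bm{d}_{k+1}(t) = \frac{-\tau_k(t)\,\bm{t}_k(t) + \kappa_k(t)\,\bm{d}_k(t)}{\sqrt{\kappa_k^2(t) + \tau_k^2(t)}}, \qquad \bm{t}_{k+2}(t) = \bm{t}_{k+1}(t)\times\bm{d}_{k+1}(t),$$ and let $\kappa_{k+1}(t) = \langle \dot{\bm{t}}_{k+1}(t), \bm{t}_{k+2}(t)\rangle$ and $\tau_{k+1}(t) = \langle \dot{\bm{d}}_{k+1}(t), \bm{t}_{k+2}(t)\rangle$ be the $(k+1)$st-order curvature and torsion. Then for all $t \in I$, $$\kappa_{k+1}(t) = r_k(t), \qquad \tau_{k+1}(t) = \dot{\theta}_k(t).$$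
   Context: All curves and maps are of class $C^\infty$; $I \subset \mathbb{R}$ is an interval; a dot denotes $d/dt$; $\langle\cdot,\cdot\rangle$ and $\times$ are the standard inner product and cross product on $\mathbb{R}^3$; $S^2$ is the unit sphere. Let $\Delta = \{(\bm{a},\bm{b}) \in S^2 \times S^2 \mid \langle \bm{a},\bm{b}\rangle = 0\}$. Legendre curve: a map $(\bm{\sigma},\bm{\nu}): I \to \Delta$ with $\langle \dot{\bm{\sigma}}(t), \bm{\nu}(t)\rangle = 0$ for all $t \in I$. A curve $\bm{\sigma}: I \to S^2$ is a frontal if there is $\bm{\nu}: I \to S^2$ such that $(\bm{\sigma},\bm{\nu})$ is a Legendre curve; then $\bm{\nu}$ is called a dual of $\bm{\sigma}$. Generalized Frenet frame: $\bm{\gamma}: I \to \mathbb{R}^3$ admits a generalized Frenet frame if there exist $\alpha: I \to \mathbb{R}$ and $\bm{t}: I \to S^2$ with $\dot{\bm{\gamma}}(t) = \alpha(t)\bm{t}(t)$ for all $t\in I$ and $\bm{t}$ is a frontal in $S^2$. $k$th-order Frenet frames $\{\bm{t}_k,\bm{d}_k,\bm{t}_{k+1}\}$ along $\bm{\gamma}$ are defined as follows. Order $0$: $\bm{t}_0 = \bm{t}$, where $\bm{t}: I \to S^2$ is a frontal in $S^2$ satisfying $\dot{\bm{\gamma}}(t) = \alpha(t)\bm{t}(t)$ for all $t \in I$ with some $\alpha: I \to \mathbb{R}$, $\bm{d}_0$ is a dual of $\bm{t}_0$, and $\bm{t}_1 = \bm{t}_0 \times \bm{d}_0$. Increasing order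 ($k \geq 1$): given the frame of order $k-1$, whenever $\bm{t}_k$ is a frontal in $S^2$, choose a dual $\bm{d}_k$ of $\bm{t}_k$ and set $\bm{t}_{k+1} = \bm{t}_k \times \bm{d}_k$. Decreasing order: given the frame $\{\bm{t}_k,\bm{d}_k,\bm{t}_{k+1}\}$ of order $k \leq 0$, choose $\theta: I \to \mathbb{R}$ with $\dot\theta(t) = \langle \dot{\bm{d}}_k(t), \bm{t}_{k+1}(t)\rangle$ and set $\bm{t}_{k-1} = \cos\theta\,\bm{d}_k - \sin\theta\,\bm{t}_{k+1}$, $\bm{d}_{k-1} = \sin\theta\,\bm{d}_k + \cos\theta\,\bm{t}_{k+1}$; then $\{\bm{t}_{k-1},\bm{d}_{k-1},\bm{t}_k\}$ is a frame of order $k-1$ (a Bishop frame: the derivatives of $\bm{t}_{k-1}$ and $\bm{d}_{k-1}$ are parallel to $\bm{t}_k$). The $k$th-order curvature and torsion are $\kappa_k(t) = \langle \dot{\bm{t}}_k(t), \bm{t}_{k+1}(t)\rangle$ and $\tau_k(t) = \langle \dot{\bm{d}}_k(t), \bm{t}_{k+1}(t)\rangle$. *)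

(* Defs.v *)
From HB Require Import structures.
From mathcomp Require Import all_boot all_order all_algebra.
From mathcomp Require Import all_classical all_reals all_analysis.

Set Implicit Arguments.
Unset Strict Implicit.
Unset Printing Implicit Defensive.

Import Order.TTheory GRing.Theory Num.Theory.
Import numFieldNormedType.Exports.

Local Open Scope classical_set_scope.
Local Open Scope ring_scope.

(** A map defined on an interval [I] is encoded as a total function on [R] of
    which only the values on [I] are used.  [I] may contain endpoints, so all
    derivatives are taken within [I] (one-sided at the endpoints); the library
    operator [derive1] would look at values outside of [I]. *)

Definition diff_quotient (R : realType) (V : normedModType R)
    (f : R -> V) (t s : R) : V := (s - t)^-1 *: (f s - f t).

Definition derivable_in (R : realType) (V : normedModType R) (I : set R)
    (f : R -> V) (t : R) : Prop := cvg (diff_quotient f t @ within I t^').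

Definition derive_in (R : realType) (V : normedModType R) (I : set R)
    (f : R -> V) (t : R) : V := lim (diff_quotient f t @ within I t^').

Definition smooth_on (R : realType) (V : normedModType R) (I : set R)
    (f : R -> V) : Prop :=
  forall (n : nat) (t : R), I t -> derivable_in I (iter n (derive_in I) f) t.

(** On a one-point interval derivatives have no meaning. *)
Definition nondegenerate_interval (R : realType) (I : set R) : Prop :=
  is_interval I /\ exists a b : R, [/\ I a, I b & a < b].

Definition dot (R : realType) (u v : 'rV[R]_3) : R :=
  \sum_(i < 3) u 0 i * v 0 i.

(** The column indices live in ['I_3], so [i + 1] and [i + 2%:R] are taken
    modulo 3. *)
Definition cross (R : realType) (u v : 'rV[R]_3) : 'rV[R]_3 :=
  \row_(i < 3) (u 0 (i + 1) * v 0 (i + 2%:R) - u 0 (i + 2%:R) * v 0 (i + 1)).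

(** The norm [`|u|] of the library is the sup norm on ['rV[R]_3], whence the
    use of [dot]. *)
Definition S2 (R : realType) : set 'rV[R]_3 := [set u | dot u u = 1].

Definition Delta (R : realType) : set ('rV[R]_3 * 'rV[R]_3) :=
  [set ab | [/\ S2 ab.1, S2 ab.2 & dot ab.1 ab.2 = 0]].

Definition legendre (R : realType) (I : set R) (sigma nu : R -> 'rV[R]_3) :
    Prop :=
  [/\ smooth_on I sigma, smooth_on I nu,
      forall s, I s -> Delta (sigma s, nu s) &
      forall s, I s -> dot (derive_in I sigma s) (nu s) = 0].

Definition is_dual (R : realType) (I : set R) (sigma nu : R -> 'rV[R]_3) :
    Prop := legendre I sigma nu.

Definition frontal (R : realType) (I : set R) (sigma : R -> 'rV[R]_3) : Prop :=
  exists nu : R -> 'rV[R]_3, legendre I sigma nu.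

Definition frontal_tangent (R : realType) (I : set R)
    (gamma t : R -> 'rV[R]_3) : Prop :=
  frontal I t /\
  exists2 alpha : R -> R, smooth_on I alpha &
    forall s, I s -> derive_in I gamma s = alpha s *: t s.

Definition admits_generalized_frenet_frame (R : realType) (I : set R)
    (gamma : R -> 'rV[R]_3) : Prop :=
  exists t : R -> 'rV[R]_3, frontal_tangent I gamma t.

Definition curvature (R : realType) (I : set R) (t t' : R -> 'rV[R]_3)
    (s : R) : R := dot (derive_in I t s) (t' s).

Definition torsion (R : realType) (I : set R) (d t' : R -> 'rV[R]_3)
    (s : R) : R := dot (derive_in I d s) (t' s).

(** [frenet_frame I gamma k t d t'] : [{t, d, t'}] is a [k]th-order Frenet
    frame along [gamma]; [t'] plays the role of [t_{k+1}] (it is not a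
    derivative). *)
Inductive frenet_frame (R : realType) (I : set R) (gamma : R -> 'rV[R]_3) :
    int -> (R -> 'rV[R]_3) -> (R -> 'rV[R]_3) -> (R -> 'rV[R]_3) -> Prop :=
| frenet_frame_zero (t0 d0 t1 : R -> 'rV[R]_3) :
    frontal_tangent I gamma t0 ->
    is_dual I t0 d0 ->
    (forall s, I s -> t1 s = cross (t0 s) (d0 s)) ->
    frenet_frame I gamma 0 t0 d0 t1
| frenet_frame_incr (k : int) (t0 d0 t1 d1 t2 : R -> 'rV[R]_3) :
    1 <= k ->
    frenet_frame I gamma (k - 1) t0 d0 t1 ->
    is_dual I t1 d1 ->
    (forall s, I s -> t2 s = cross (t1 s) (d1 s)) ->
    frenet_frame I gamma k t1 d1 t2
| frenet_frame_decr (k : int) (t0 d0 t1 tm dm : R -> 'rV[R]_3)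
    (theta : R -> R) :
    k <= 0 ->
    frenet_frame I gamma k t0 d0 t1 ->
    smooth_on I theta ->
    (forall s, I s -> derive_in I theta s = torsion I d0 t1 s) ->
    (forall s, I s -> tm s = cos (theta s) *: d0 s - sin (theta s) *: t1 s) ->
    (forall s, I s -> dm s = sin (theta s) *: d0 s + cos (theta s) *: t1 s) ->
    frenet_frame I gamma (k - 1) tm dm t0.

(* Main.v *)
Require Import Defs.
From HB Require Import structures.
From mathcomp Require Import all_boot all_order all_algebra.
From mathcomp Require Import all_classical all_reals all_analysis.
From mathcomp Require Import ring lra.

(** In an orthonormal frame [{t, d, t1}] with [t1 = t x d] in which the
    derivative of [t] is orthogonal to [d], the derivatives are
      [t' = kappa t1],  [d' = tau t1],  [t1' = - kappa t - tau d],
    because the derivative of an orthonormal frame is skew-symmetric in that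
    frame.  Frames of every order are of this kind: for frames coming from a
    Legendre curve this is [legendre_frenet], and [frenet_rotate] shows that it
    is preserved when the order decreases ([frenet_frame_equations]).

    Put [(kappa, tau) = (r cos theta, r sin theta)] with [r <> 0].  Then
    [d1 = - sin theta t + cos theta d] and
    [t2 = t1 x d1 = - cos theta t - sin theta d].  Since
    [t1' = - r (cos theta t + sin theta d) = r t2], the new curvature is [r].
    In the derivative of [d1], the contributions of [t'] and [d'] are along
    [t1], hence orthogonal to [t2], and the remaining term is
    [theta' (- cos theta t - sin theta d) = theta' t2]; the new torsion is
    therefore [theta'] ([frenet_advance]).

    All derivatives are limits of difference quotients within [I], so the
    usual rules of derivation are established for these limits. *)

Set Implicit Arguments.
Unset Strict Implicit.
Unset Printing Implicit Defensive.

Import Order.TTheory GRing.Theory Num.Theory.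
Import numFieldNormedType.Exports.

Local Open Scope classical_set_scope.
Local Open Scope ring_scope.

(** * Derivatives within an interval *)

(** This is what makes limits within [I^'] unique, hence [derive_in]
    computable.  A second point [c] of [I] gives the points [t + e (c - t)] of
    [I], which tend to [t] as [e] decreases to 0. *)
Lemma interval_punctured_proper (R : realType) (I : set R) (t : R) :
  nondegenerate_interval I -> I t -> ProperFilter (within I t^').
Proof.
move=> [itvI [a [b [Ia Ib ab]]]] It; apply: Build_ProperFilter_ex => A AI.
have [c Ic ct] : exists2 c, I c & c != t.
  have [at_|] := eqVneq a t; last by exists a.
  by exists b; rewrite // -at_ gt_eqF.
have cvg_t : (fun e : R => t + e * (c - t)) e @[e --> 0^'+] --> t.
  apply: cvg_at_right_filter.
  suff : (fun e : R => t + e * (c - t)) e @[e --> 0] --> t + 0 * (c - t).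
    by rewrite mul0r addr0.
  apply: cvgD; first exact: cvg_cst.
  by apply: cvgM; [exact: cvg_id | exact: cvg_cst].
have /cvg_t near_A : nbhs t (fun s => s != t -> I s -> A s) by exact: AI.
have : \forall e \near 0^'+, A (t + e * (c - t)).
  near=> e.
  have e0 : 0 < e by near: e; exact: nbhs_right_gt.
  have e1 : e < 1 by near: e; exact: nbhs_right_lt.
  have en0 : e != 0 by rewrite gt_eqF.
  have ct0 : c - t != 0 by rewrite subr_eq0.
  have : t + e * (c - t) != t -> I (t + e * (c - t)) -> A (t + e * (c - t)).
    by near: e; exact: near_A.
  apply.
  - by rewrite -subr_eq0 addrC addKr mulf_neq0.
  - have -> : t + e * (c - t) = (1 - e) * t + e * c by ring.
    case: (ltgtP c t) ct0 => [ctl|tc|->]; last by rewrite subrr eqxx.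
    + move=> _; apply: (itvI c t) => //; apply/andP; split; rewrite -subr_ge0.
        have -> : (1 - e) * t + e * c - c = (1 - e) * (t - c) by ring.
        by apply: mulr_ge0; rewrite ?subr_ge0 ltW.
      have -> : t - ((1 - e) * t + e * c) = e * (t - c) by ring.
      by apply: mulr_ge0; rewrite ?subr_ge0 ltW.
    + move=> _; apply: (itvI t c) => //; apply/andP; split; rewrite -subr_ge0.
        have -> : (1 - e) * t + e * c - t = e * (c - t) by ring.
        by apply: mulr_ge0; rewrite ?subr_ge0 ltW.
      have -> : c - ((1 - e) * t + e * c) = (1 - e) * (c - t) by ring.
      by apply: mulr_ge0; rewrite ?subr_ge0 ltW.
by move=> /filter_ex [e Ae]; exists (t + e * (c - t)).
Unshelve. all: by end_near. Qed.

(** Unlike an equation on [derive_in], this asserts that the limit exists, so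
    that derivation rules compose. *)
Definition has_derive_in (R : realType) (V : normedModType R) (I : set R)
    (f : R -> V) (t : R) (l : V) : Prop :=
  diff_quotient f t @ within I t^' --> l.

Lemma has_derive_in_eq (R : realType) (V : normedModType R) (I : set R)
    (f g : R -> V) (t : R) (l : V) :
  I t -> (forall s, I s -> f s = g s) ->
  has_derive_in I f t l -> has_derive_in I g t l.
Proof.
move=> It fg; apply: cvg_trans; apply: near_eq_cvg.
by rewrite near_withinE; apply: nearW => s Is; rewrite /diff_quotient !fg.
Qed.

Lemma has_derive_in_cst (R : realType) (V : normedModType R) (I : set R)
    (c : V) (t : R) : has_derive_in I (fun=> c) t 0.
Proof.
rewrite /has_derive_in (_ : diff_quotient _ t = fun=> 0); first exact: cvg_cst.
by apply/funext => s; rewrite /diff_quotient subrr scaler0.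
Qed.

Lemma has_derive_inP (R : realType) (V : normedModType R) (I : set R)
    (f : R -> V) (t : R) :
  derivable_in I f t -> has_derive_in I f t (derive_in I f t).
Proof. by []. Qed.

Lemma derive_inE (R : realType) (V : normedModType R) (I : set R)
    (f : R -> V) (t : R) (l : V) : nondegenerate_interval I -> I t ->
  has_derive_in I f t l -> derive_in I f t = l.
Proof.
move=> hI It fl; have FF := interval_punctured_proper hI It.
exact: cvg_lim fl.
Qed.

Section scalar_rules.
Context {R : realType} (I : set R) (t : R).
Implicit Types f g : R -> R.

Lemma has_derive_in_cvg f l :
  has_derive_in I f t l -> f @ within I t^' --> f t.
Proof.
move=> fl.
have : (fun s => f t + (s - t) * diff_quotient f t s) s @[s --> within I t^']
    --> f t + (t - t) * l.
  apply: cvgD; first exact: cvg_cst.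
  apply: cvgM => //; apply: cvgB; last exact: cvg_cst.
  by apply: cvg_within_filter; exact: nbhs_dnbhs.
rewrite subrr mul0r addr0; apply: cvg_trans; apply: near_eq_cvg.
rewrite near_withinE; near=> s => _.
have st : s - t != 0 by rewrite subr_eq0; near: s; exact: nbhs_dnbhs_neq.
by rewrite /diff_quotient /GRing.scale /= mulrA mulfV// mul1r addrC subrK.
Unshelve. all: by end_near. Qed.

Lemma has_derive_inD f g l m : has_derive_in I f t l -> has_derive_in I g t m ->
  has_derive_in I (fun s => f s + g s) t (l + m).
Proof.
move=> fl gm; apply: (cvg_trans _ (cvgD fl gm)); apply: near_eq_cvg.
by apply: nearW => s; rewrite /diff_quotient /GRing.scale /= ?fctE /=; ring.
Qed.

Lemma has_derive_inM f g l m : has_derive_in I f t l -> has_derive_in I g t m ->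
  has_derive_in I (fun s => f s * g s) t (l * g t + f t * m).
Proof.
move=> fl gm; have gc := has_derive_in_cvg gm.
apply: (cvg_trans _ (cvgD (cvgM fl gc) (cvgM (cvg_cst (f t)) gm))).
apply: near_eq_cvg.
by apply: nearW => s; rewrite /diff_quotient /GRing.scale /= ?fctE /=; ring.
Qed.

Lemma has_derive_inN f l : has_derive_in I f t l ->
  has_derive_in I (fun s => - f s) t (- l).
Proof.
move=> fl; apply: (cvg_trans _ (cvgN fl)); apply: near_eq_cvg.
by apply: nearW => s; rewrite /diff_quotient /GRing.scale /= ?fctE /=; ring.
Qed.

(** The difference quotient of [g] at [f t], extended by [m] at [f t] itself,
    is continuous there; this avoids dividing by [f s - f t], which may vanish
    arbitrarily close to [t]. *)
Lemma has_derive_in_comp (g : R -> R) f l m : is_derive (f t) 1 g m ->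
  has_derive_in I f t l -> has_derive_in I (fun s => g (f s)) t (m * l).
Proof.
move=> gm fl.
pose q h := if h == 0 then m else h^-1 * (g (h + f t) - g (f t)).
have q0 : q @ 0 --> m.
  suff : q @ 0 --> q 0 by rewrite {2}/q eqxx.
  apply/continuous_withinNx; rewrite {2}/q eqxx.
  have [gd <-] := gm; apply: cvg_trans gd; apply: near_eq_cvg.
  near=> h.
  have h0 : h != 0 by near: h; exact: nbhs_dnbhs_neq.
  by rewrite /q (negbTE h0) /= /GRing.scale /= mulr1.
have df0 : (fun s => f s - f t) s @[s --> within I t^'] --> 0.
  rewrite -(subrr (f t)); apply: cvgB; last exact: cvg_cst.
  exact: has_derive_in_cvg fl.
apply: (cvg_trans _ (cvgM (cvg_comp _ _ df0 q0) fl)); apply: near_eq_cvg.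
apply: nearW => s; rewrite /diff_quotient /GRing.scale /= /q subrK subr_eq0.
case: eqVneq => [->|fst]; first by rewrite !subrr !mulr0.
by move: (s - t)^-1 (g (f s) - g (f t)) => u v; field; rewrite subr_eq0.
Unshelve. all: by end_near. Qed.

End scalar_rules.

(** * Inner and cross product *)

Section vectors.
Context {R : realType}.
Implicit Types u v w : 'rV[R]_3.

Lemma row3P u v : u 0 0 = v 0 0 -> u 0 1 = v 0 1 -> u 0 2%:R = v 0 2%:R ->
  u = v.
Proof.
move=> e0 e1 e2; apply/rowP; case=> -[|[|[|//]]] lt_i3.
- by rewrite (_ : Ordinal _ = 0) //; exact: val_inj.
- by rewrite (_ : Ordinal _ = 1) //; exact: val_inj.
- by rewrite (_ : Ordinal _ = 2%:R) //; exact: val_inj.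
Qed.

Lemma dotE u v : dot u v = u 0 0 * v 0 0 + u 0 1 * v 0 1 + u 0 2%:R * v 0 2%:R.
Proof.
rewrite /dot !big_ord_recl big_ord0 addr0 addrA.
by congr (_ * _ + _ * _ + _ * _); congr (_ _ _); exact: val_inj.
Qed.

Lemma crossE u v :
  [/\ cross u v 0 0 = u 0 1 * v 0 2%:R - u 0 2%:R * v 0 1,
      cross u v 0 1 = u 0 2%:R * v 0 0 - u 0 0 * v 0 2%:R &
      cross u v 0 2%:R = u 0 0 * v 0 1 - u 0 1 * v 0 0].
Proof.
have e3 : (1 + 2%:R = 0 :> 'I_3) by exact: val_inj.
have e4 : (2%:R + 1 = 0 :> 'I_3) by exact: val_inj.
have e5 : (2%:R + 2%:R = 1 :> 'I_3) by exact: val_inj.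
have e2 : (1 + 1 = 2%:R :> 'I_3) by exact: val_inj.
by split; rewrite mxE ?add0r ?e2 ?e3 ?e4 ?e5.
Qed.

Lemma dotC u v : dot u v = dot v u.
Proof. by rewrite !dotE; ring. Qed.

Lemma dotDl u v w : dot (u + v) w = dot u w + dot v w.
Proof. by rewrite !dotE !mxE; ring. Qed.

Lemma dotZl a u v : dot (a *: u) v = a * dot u v.
Proof. by rewrite !dotE !mxE; ring. Qed.

Lemma dotDr u v w : dot u (v + w) = dot u v + dot u w.
Proof. by rewrite !dotE !mxE; ring. Qed.

Lemma dotZr a u v : dot u (a *: v) = a * dot u v.
Proof. by rewrite !dotE !mxE; ring. Qed.

Lemma crossC u v : cross u v = - cross v u.
Proof. by apply/rowP => i; rewrite !mxE; ring. Qed.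

Lemma cross_cross u v w : cross (cross u v) w = dot u w *: v - dot v w *: u.
Proof.
have [u0 u1 u2] := crossE u v; have [v0 v1 v2] := crossE (cross u v) w.
by apply: row3P; rewrite ?(v0, v1, v2) ?(u0, u1, u2) !dotE !mxE; ring.
Qed.

Lemma dot_cross u v : dot (cross u v) (cross u v) =
  dot u u * dot v v - dot u v ^+ 2.
Proof. by have [u0 u1 u2] := crossE u v; rewrite !dotE u0 u1 u2; ring. Qed.

Lemma dot_crossl u v : dot u (cross u v) = 0.
Proof. by have [u0 u1 u2] := crossE u v; rewrite !dotE u0 u1 u2; ring. Qed.

Lemma dot_crossr u v : dot v (cross u v) = 0.
Proof. by have [u0 u1 u2] := crossE u v; rewrite !dotE u0 u1 u2; ring. Qed.

End vectors.

(** * Derivatives of vectors *)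

(** Reduces the rules for vectors to those for scalar functions. *)
Lemma has_derive_in_coord (R : realType) (n : nat) (I : set R)
    (f : R -> 'rV[R]_n.+1) (t : R) (l : 'rV[R]_n.+1) :
  has_derive_in I f t l <->
  forall i, has_derive_in I (fun s => f s 0 i) t (l 0 i).
Proof.
split=> [fl i|fl A [P lP PA]].
  apply: (cvg_trans _ (cvg_comp _ _ fl (@coord_continuous _ _ _ 0 i l))).
  by apply: near_eq_cvg; apply: nearW => s; rewrite /diff_quotient /= !mxE.
have : \forall s \near within I t^', forall i, P 0 i (diff_quotient f t s 0 i).
  apply: filter_forall => i; have := fl i _ (lP 0 i).
  rewrite (_ : diff_quotient _ t = fun s => diff_quotient f t s 0 i) //.
  by apply/funext => s; rewrite /diff_quotient !mxE.
by apply: filterS => s Ps; apply: PA => i j; rewrite (ord1 i); exact: Ps.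
Qed.

Section vector_rules.
Context {R : realType} (I : set R) (s : R).
Implicit Types (a : R -> R) (f g : R -> 'rV[R]_3).

Lemma has_derive_in_vecD f g l m :
  has_derive_in I f s l -> has_derive_in I g s m ->
  has_derive_in I (fun x => f x + g x) s (l + m).
Proof.
move=> /has_derive_in_coord fl /has_derive_in_coord gm.
apply/has_derive_in_coord => i; have := has_derive_inD (fl i) (gm i).
rewrite !mxE; congr (has_derive_in _ _ _ _).
by apply/funext => x; rewrite mxE.
Qed.

Lemma has_derive_in_vecZ a f b l :
  has_derive_in I a s b -> has_derive_in I f s l ->
  has_derive_in I (fun x => a x *: f x) s (b *: f s + a s *: l).
Proof.
move=> ab /has_derive_in_coord fl.
apply/has_derive_in_coord => i; have := has_derive_inM ab (fl i).
rewrite !mxE; congr (has_derive_in _ _ _ _).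
by apply/funext => x; rewrite mxE.
Qed.

Lemma has_derive_in_dot f g l m :
  has_derive_in I f s l -> has_derive_in I g s m ->
  has_derive_in I (fun x => dot (f x) (g x)) s (dot l (g s) + dot (f s) m).
Proof.
move=> /has_derive_in_coord fl /has_derive_in_coord gm.
have fg i := has_derive_inM (fl i) (gm i).
have := has_derive_inD (has_derive_inD (fg 0) (fg 1)) (fg 2%:R).
congr (has_derive_in _ _ _ _); first by apply/funext => x; rewrite dotE.
by rewrite !dotE; ring.
Qed.

Lemma has_derive_in_cross f g l m :
  has_derive_in I f s l -> has_derive_in I g s m ->
  has_derive_in I (fun x => cross (f x) (g x)) s
    (cross l (g s) + cross (f s) m).
Proof.
move=> /has_derive_in_coord fl /has_derive_in_coord gm.
have fg i j := has_derive_inM (fl i) (gm j).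
apply/has_derive_in_coord => i.
have := has_derive_inD (fg (i + 1) (i + 2%:R))
  (has_derive_inN (fg (i + 2%:R) (i + 1))).
congr (has_derive_in _ _ _ _); first by apply/funext => x; rewrite mxE.
by rewrite !mxE; ring.
Qed.

(** Used to show that derivatives of vectors of an orthonormal frame have a
    skew-symmetric matrix in this frame. *)
Lemma dot_cst_derive f g l m c :
  nondegenerate_interval I -> I s ->
  (forall x, I x -> dot (f x) (g x) = c) ->
  has_derive_in I f s l -> has_derive_in I g s m ->
  dot l (g s) + dot (f s) m = 0.
Proof.
move=> hI Is fgc fl gm; rewrite -(derive_inE hI Is (has_derive_in_dot fl gm)).
apply: derive_inE => //.
apply: (@has_derive_in_eq _ _ _ (fun=> c)) => // [x /fgc //|].
exact: has_derive_in_cst.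
Qed.

End vector_rules.

(** * Frenet equations *)

(** With [n = u x v], the double product formula gives [n x w = 0] because [w]
    is orthogonal to [u] and [v]; the same formula for [(n x w) x n] then
    expresses [w] as a multiple of the unit vector [n]. *)
Lemma orthonormal_expand (R : realType) (u v w : 'rV[R]_3) :
  S2 u -> S2 v -> dot u v = 0 -> dot w u = 0 -> dot w v = 0 ->
  w = dot w (cross u v) *: cross u v.
Proof.
rewrite /S2 /= => uu vv uv wu wv; set n := cross u v.
have nw : cross n w = 0 by rewrite cross_cross !(dotC _ w) wu wv !scale0r subrr.
have nn : dot n n = 1 by rewrite dot_cross uu vv uv expr0n mulr1 subr0.
have := cross_cross n w n.
rewrite nw nn scale1r (_ : cross 0 n = 0); last first.
  by apply/rowP => i; rewrite !mxE; ring.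
by move=> /esym/eqP; rewrite subr_eq0 => /eqP.
Qed.

(** What the argument uses of a frame.  Given orthonormality, the derivatives
    of [t] and [d] being multiples of [t1] is the Legendre condition;
    smoothness is reduced to the existence of these two derivatives, so that
    no smoothness has to be carried through the decreasing steps. *)
Record frenet_equations (R : realType) (I : set R)
    (t d t1 : R -> 'rV[R]_3) (kappa tau : R -> R) (s : R) : Prop :=
  FrenetEquations {
    frenet_Delta : Delta (t s, d s) ;
    frenet_cross : t1 s = cross (t s) (d s) ;
    frenet_t : has_derive_in I t s (kappa s *: t1 s) ;
    frenet_d : has_derive_in I d s (tau s *: t1 s) }.

Section frames.
Context {R : realType} (I : set R) (hI : nondegenerate_interval I).

(** Derivation of the three orthonormality relations, together with the
    Legendre condition, shows that [t] and [d] have derivatives orthogonal to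
    both [t] and [d], hence parallel to their cross product. *)
Lemma legendre_frenet (t d t1 : R -> 'rV[R]_3) :
  legendre I t d -> (forall s, I s -> t1 s = cross (t s) (d s)) ->
  forall s, I s ->
    frenet_equations I t d t1 (curvature I t t1) (torsion I d t1) s.
Proof.
move=> [t_smooth d_smooth td_Delta td0] t1E s Is.
have t' := has_derive_inP (t_smooth 0 s Is).
have d' := has_derive_inP (d_smooth 0 s Is).
have tt x : I x -> dot (t x) (t x) = 1 by case/td_Delta.
have dd x : I x -> dot (d x) (d x) = 1 by case/td_Delta.
have td x : I x -> dot (t x) (d x) = 0 by case/td_Delta.
have := dot_cst_derive hI Is tt t' t'.
have := dot_cst_derive hI Is dd d' d'.
have := dot_cst_derive hI Is td t' d'.
rewrite /= td0 // add0r (dotC (t s)) (dotC (d s)) (dotC (t s)) => d't d'd t't.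
split; [exact: td_Delta | exact: t1E | |].
  rewrite /curvature t1E // -orthonormal_expand //;
    [exact: tt | exact: dd | exact: td | lra | exact: td0].
by rewrite /torsion t1E // -orthonormal_expand //;
  [exact: tt | exact: dd | exact: td | lra].
Qed.

Section equations.
Context (t d t1 : R -> 'rV[R]_3) (kappa tau : R -> R) (s : R) (Is : I s)
  (feq : forall x, I x -> frenet_equations I t d t1 kappa tau x).

Lemma frenet_t1_unit : dot (t1 s) (t1 s) = 1.
Proof.
have [[/= tt dd td] -> _ _] := feq Is.
by rewrite dot_cross tt dd td expr0n mulr1 subr0.
Qed.

(** The third Frenet equation follows from [t1 = t x d] by the product rule. *)
Lemma frenet_t1 : has_derive_in I t1 s (- kappa s *: t s - tau s *: d s).
Proof.
have [[/= tt dd td] t1E t' d'] := feq Is.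
apply: (@has_derive_in_eq _ _ _ (fun x => cross (t x) (d x))) => //.
  by move=> x Ix; rewrite (frenet_cross (feq Ix)).
have := has_derive_in_cross t' d'; congr (has_derive_in _ _ _ _).
have crossZl a u v : cross (a *: u) v = a *: cross u v :> 'rV[R]_3.
  by apply/rowP => i; rewrite !mxE; ring.
rewrite (crossC (t s)) !crossZl t1E !cross_cross.
rewrite (dotC (d s) (t s)) tt dd td !scale0r !scale1r.
by rewrite sub0r subr0 scalerN scaleNr.
Qed.

Lemma frenet_curvature : curvature I t t1 s = kappa s.
Proof.
rewrite /curvature (derive_inE hI Is (frenet_t (feq Is))) dotZl.
by rewrite frenet_t1_unit mulr1.
Qed.

Lemma frenet_torsion : torsion I d t1 s = tau s.
Proof.
rewrite /torsion (derive_inE hI Is (frenet_d (feq Is))) dotZl.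
by rewrite frenet_t1_unit mulr1.
Qed.

End equations.

(** The decreasing step: the rotation of angle [theta] in the plane of [d] and
    [t1] turns at the speed [tau], which cancels the component of the
    derivative of [tm] along [dm] and leaves derivatives parallel to [t]. *)
Lemma frenet_rotate (t d t1 tm dm : R -> 'rV[R]_3)
    (kappa tau theta : R -> R) :
  (forall s, I s -> frenet_equations I t d t1 kappa tau s) ->
  (forall s, I s -> has_derive_in I theta s (tau s)) ->
  (forall s, I s -> tm s = cos (theta s) *: d s - sin (theta s) *: t1 s) ->
  (forall s, I s -> dm s = sin (theta s) *: d s + cos (theta s) *: t1 s) ->
  forall s, I s -> frenet_equations I tm dm t
    (fun x => kappa x * sin (theta x))
    (fun x => - (kappa x * cos (theta x))) s.
Proof.
move=> feq theta' tmE dmE s Is.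
have [[/= tt dd td] t1E t' d'] := feq s Is.
have t1t1 := frenet_t1_unit Is feq; have t1' := frenet_t1 Is feq.
have dt1 : dot (d s) (t1 s) = 0 by rewrite t1E dot_crossr.
have cs := cos2Dsin2 (theta s).
have cos' := has_derive_in_comp (is_derive_cos _) (theta' s Is).
have sin' := has_derive_in_comp (is_derive_sin _) (theta' s Is).
split.
- split; rewrite /S2 /= ?tmE ?dmE // -?scaleNr !(dotDl, dotDr, dotZl, dotZr);
    rewrite (dotC (t1 s)) dd dt1 t1t1; move: cs; lra.
(* A rotation of the plane preserves the cross product. *)
- rewrite tmE ?dmE // (_ : cross _ _ =
    (cos (theta s) ^+ 2 + sin (theta s) ^+ 2) *: cross (d s) (t1 s)).
    rewrite cs scale1r crossC t1E cross_cross td dd.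
    by rewrite scale0r scale1r sub0r opprK.
  by apply/rowP => i; rewrite !mxE; ring.
- apply: (has_derive_in_eq Is (fun x Ix => esym (tmE x Ix))).
  have := has_derive_in_vecD (has_derive_in_vecZ cos' d')
    (has_derive_in_vecZ (has_derive_inN sin') t1').
  congr (has_derive_in _ _ _ _).
    by apply/funext => x; rewrite scaleNr.
  by apply/rowP => i; rewrite !mxE; ring.
- apply: (has_derive_in_eq Is (fun x Ix => esym (dmE x Ix))).
  have := has_derive_in_vecD (has_derive_in_vecZ sin' d')
    (has_derive_in_vecZ cos' t1').
  congr (has_derive_in _ _ _ _).
  by apply/rowP => i; rewrite !mxE; ring.
Qed.

Lemma frenet_frame_equations gamma k (t d t1 : R -> 'rV[R]_3) :
  frenet_frame I gamma k t d t1 -> exists kappa tau,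
    forall s, I s -> frenet_equations I t d t1 kappa tau s.
Proof.
elim=> {k t d t1}
  [t0 d0 t1 _ /legendre_frenet leg /leg feq
  |k t0 d0 t1 d1 t2 _ _ _ /legendre_frenet leg /leg feq
  |k t d t1 tm dm theta _ _ [kappa [tau feq]] th_smooth th_tau tmE dmE].
- by exists (curvature I t0 t1), (torsion I d0 t1).
- by exists (curvature I t1 t2), (torsion I d1 t2).
- exists (fun x => kappa x * sin (theta x)).
  exists (fun x => - (kappa x * cos (theta x))).
  apply: (frenet_rotate feq _ tmE dmE) => s Is.
  rewrite -(frenet_torsion Is feq) -th_tau //.
  exact: has_derive_inP (th_smooth 0 s Is).
Qed.

(** In the polar form of [(kappa, tau)], the pair [(d1, t2)] is the image of
    [(t, d)] under a rotation, by the angle [theta] up to a constant, of the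
    plane of [t] and [d].  As [t] and [d] vary only along [t1], [d1] moves
    within this plane only through [theta]. *)
Lemma frenet_advance (t d t1 d1 t2 : R -> 'rV[R]_3)
    (kappa tau r theta : R -> R) (s : R) :
  (forall s, I s -> frenet_equations I t d t1 kappa tau s) ->
  smooth_on I theta ->
  (forall s, I s -> kappa s = r s * cos (theta s)) ->
  (forall s, I s -> tau s = r s * sin (theta s)) ->
  (forall s, I s -> d1 s = - sin (theta s) *: t s + cos (theta s) *: d s) ->
  (forall s, I s -> t2 s = cross (t1 s) (d1 s)) -> I s ->
  curvature I t1 t2 s = r s /\ torsion I d1 t2 s = derive_in I theta s.
Proof.
move=> feq th_smooth kappaE tauE d1E t2E Is.
have [[/= tt dd td] t1E t' d'] := feq s Is.
have dt1 : dot (d s) (t1 s) = 0 by rewrite t1E dot_crossr.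
have tt1 : dot (t s) (t1 s) = 0 by rewrite t1E dot_crossl.
have cs := cos2Dsin2 (theta s).
have theta' : has_derive_in I theta s (derive_in I theta s).
  exact: has_derive_inP (th_smooth 0 s Is).
have cos' := has_derive_in_comp (is_derive_cos _) theta'.
have sin' := has_derive_in_comp (is_derive_sin _) theta'.
have t2s : t2 s = - cos (theta s) *: t s + - sin (theta s) *: d s.
  rewrite t2E // t1E cross_cross d1E // !(dotDr, dotZr) (dotC (d s)) tt dd td.
  by apply/rowP => i; rewrite !mxE; ring.
split.
  rewrite /curvature (derive_inE hI Is (frenet_t1 Is feq)) t2s.
  rewrite -!scaleNr !(dotDl, dotDr, dotZl, dotZr) (dotC (d s)) tt dd td.
  rewrite -[RHS]mulr1 -[X in _ = _ * X]cs kappaE // tauE //; ring.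
have d1' := has_derive_in_eq Is (fun x Ix => esym (d1E x Ix))
  (has_derive_in_vecD (has_derive_in_vecZ (has_derive_inN sin') t')
     (has_derive_in_vecZ cos' d')).
rewrite /torsion (derive_inE hI Is d1') t2s.
rewrite !(dotDl, dotDr, dotZl, dotZr) (dotC (d s) (t s)) !(dotC (t1 s)).
rewrite tt dd td dt1 tt1 -[RHS]mulr1 -[X in _ = _ * X]cs; ring.
Qed.

End frames.

Unset Implicit Arguments.

Theorem corollary4p6 (R : realType) (I : set R)
    (hI : nondegenerate_interval I)
    (gamma : R -> 'rV[R]_3)
    (hgamma : smooth_on I gamma)
    (hadm : admits_generalized_frenet_frame I gamma)
    (k : int) (tk dk tk1 : R -> 'rV[R]_3)
    (hframe : frenet_frame I gamma k tk dk tk1)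
    (kappa tau : R -> R)
    (hkappa : forall s, I s -> kappa s = curvature I tk tk1 s)
    (htau : forall s, I s -> tau s = torsion I dk tk1 s)
    (hnz : forall s, I s -> (kappa s, tau s) <> (0, 0))
    (r theta : R -> R)
    (hr : forall s, I s -> r s = Num.sqrt (kappa s ^+ 2 + tau s ^+ 2))
    (htheta : smooth_on I theta)
    (hpolar : forall s, I s ->
      (kappa s, tau s) = (r s * cos (theta s), r s * sin (theta s)))
    (dk1 tk2 : R -> 'rV[R]_3)
    (hdk1 : forall s, I s ->
      dk1 s = (Num.sqrt (kappa s ^+ 2 + tau s ^+ 2))^-1 *:
                (- tau s *: tk s + kappa s *: dk s))
    (htk2 : forall s, I s -> tk2 s = cross (tk1 s) (dk1 s))
    (s : R) (hs : I s) :
  curvature I tk1 tk2 s = r s /\ torsion I dk1 tk2 s = derive_in I theta s.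
Proof.
have [kap [ta feq]] := frenet_frame_equations hI hframe.
have kapE x : I x -> kappa x = kap x.
  by move=> Ix; rewrite hkappa // (frenet_curvature hI Ix feq).
have taE x : I x -> tau x = ta x.
  by move=> Ix; rewrite htau // (frenet_torsion hI Ix feq).
apply: (frenet_advance hI feq htheta) htk2 hs => x Ix.
- by rewrite -kapE //; case: (hpolar x Ix).
- by rewrite -taE //; case: (hpolar x Ix).
- have [kE tE] := hpolar x Ix.
  have r0 : r x != 0.
    by apply/eqP => rx0; apply: (hnz x Ix); rewrite kE tE rx0 !mul0r.
  rewrite hdk1 // -hr // scalerDr !scalerA kE tE mulrN.
  by rewrite !mulKf.
Qed.
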